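(* Let $m$ and $n$ be integers greater than $2$. Then $F(C_m \boxtimes C_n) \geq \left\lceil \frac{mn}{2} \right\rceil$.
   Context: All graphs are simple, finite and undirected; $C_k$ is the cycle on $k$ vertices. The strong product $G \boxtimes H$ has vertex set $V(G)\times V(H)$, with $(u,v)$ adjacent to $(u',v')$ iff ($uu'\in E(G)$ and $vv'\in E(H)$), or ($u=u'$ and $vv'\in E(H)$), or ($v=v'$ and $uu'\in E(G)$). Zero forcing: each vertex is blue or white; starting from an initial set $S$ of blue vertices, repeatedly apply the color-change rule: if a blue vertex $u$ has exactly one white neighbor $v$, color $v$ blue. $S$ is a zero forcing set if eventually all vertices are blue, and a failed zero forcing set otherwise. $F(G)$ denotes the maximum cardinality of a failed zero forcing set of $G$. *)

(* Defs.v *)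
From mathcomp Require Import all_boot.

Set Implicit Arguments.
Unset Strict Implicit.
Unset Printing Implicit Defensive.

Record sgraph := SGraph {
  vertex :> finType;
  adj : rel vertex;
  adj_sym : symmetric adj;
  adj_irrefl : irreflexive adj
}.

(* The conjunct [i != j] only matters for k = 1, where it excludes a loop;
   for k >= 3 this is the usual k-cycle 0 - 1 - ... - (k-1) - 0. *)
Definition cycle_adj (k : nat) : rel 'I_k :=
  fun i j => (i != j) && ((j == i.+1 %% k :> nat) || (i == j.+1 %% k :> nat)).

Lemma cycle_adj_sym k : symmetric (@cycle_adj k).
Proof. by move=> i j; rewrite /cycle_adj eq_sym orbC. Qed.

Lemma cycle_adj_irrefl k : irreflexive (@cycle_adj k).
Proof. by move=> i; rewrite /cycle_adj eqxx. Qed.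

Definition cycle_graph (k : nat) : sgraph :=
  SGraph (@cycle_adj_sym k) (@cycle_adj_irrefl k).

Section StrongProduct.
Variables G H : sgraph.

Definition strong_adj : rel (G * H) := fun x y =>
  [|| adj x.1 y.1 && adj x.2 y.2,
      (x.1 == y.1) && adj x.2 y.2
    | (x.2 == y.2) && adj x.1 y.1].

Lemma strong_adj_sym : symmetric strong_adj.
Proof.
move=> x y; rewrite /strong_adj (adj_sym x.1) (adj_sym x.2).
by rewrite (eq_sym x.1) (eq_sym x.2).
Qed.

Lemma strong_adj_irrefl : irreflexive strong_adj.
Proof. by move=> x; rewrite /strong_adj !adj_irrefl !andbF. Qed.

Definition strong_product : sgraph := SGraph strong_adj_sym strong_adj_irrefl.

End StrongProduct.

Section ZeroForcing.
Variable G : sgraph.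
Implicit Types (B S : {set G}) (u v : G).

Definition white_neighbors B u : {set G} := [set v | adj u v & v \notin B].

(* One application of the color-change rule, as a relation between the
   successive sets of blue vertices. *)
Definition color_change : rel {set G} := fun B B' =>
  [exists u in B, exists v,
     (white_neighbors B u == [set v]) && (B' == v |: B)].

Definition zero_forcing S : bool := connect color_change S [set: G].

Definition failed_zero_forcing S : bool := ~~ zero_forcing S.

(* On a graph with at least one vertex the empty set is failed, so this is a
   maximum over a nonempty family. *)
Definition failed_zf_number : nat :=
  \max_(S : {set G} | failed_zero_forcing S) #|S|.

End ZeroForcing.

(* Main.v *)
Require Import Defs.
From mathcomp Require Import all_boot.
From mathcomp Require Import zify.

(** Make a single fibre [{i} x C_n] white and everything else blue. A blue vertex
    [(a, b)] with a white neighbor has [a] adjacent to [i], hence it sees both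
    [(i, b)] and [(i, b + 1)]: no vertex can force, although only [n <= m * n / 2]
    vertices are white. *)

Lemma stalled_failed (G : sgraph) (S : {set G}) :
  S != setT -> (forall B, ~~ color_change S B) -> failed_zero_forcing S.
Proof.
move=> SnT Sstalled; apply/connectP => -[[|B p] /=].
  by move=> _ ST; rewrite ST eqxx in SnT.
by rewrite (negPf (Sstalled B)).
Qed.

Lemma cycle_has_neighbor (n : nat) (j : cycle_graph n) :
  1 < n -> exists k, adj j k.
Proof.
move=> n_gt1; have n_gt0 := ltnW n_gt1.
exists (Ordinal (ltn_pmod j.+1 n_gt0)).
rewrite /= /cycle_adj /= eqxx /= andbT -val_eqE /=.
(* In the wrap-around case the successor is [0], and [1 < n] makes [j = n - 1] nonzero. *)
have := ltn_ord j; rewrite leq_eqVlt => /orP[/eqP jn | jn].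
  by rewrite jn modnn -lt0n -ltnS jn.
by rewrite modn_small // neq_ltn ltnSn.
Qed.

(** Any neighbor [l] of [b] in [H] can replace the cyclic successor: [(i, l)] is then a second white
    neighbor besides [(i, b)]. *)
Lemma fiber_complement_failed (G H : sgraph) (i : G) (j : H) :
  (forall k : H, exists l, adj k l) ->
  failed_zero_forcing (G := strong_product G H) (~: [set x | x.1 == i]).
Proof.
move=> Hnbr; apply: stalled_failed.
  by apply/eqP => /setP/(_ (i, j)); rewrite !inE eqxx.
move=> B; apply/negP => /exists_inP[[a b]]; rewrite !inE /= => ai.
case/existsP=> v /andP[/eqP/setP Wv _].
(* The forced vertex [v] is white, so it lies over [i]; as [a != i], its adjacency to [(a, b)] must
   move the first coordinate. *)
have ai_adj : adj a i.
  have := Wv v; rewrite !inE eqxx negbK /= /strong_adj /= => /andP[av /eqP vi].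
  by move: av; rewrite vi (negPf ai) /= => /orP[] /andP[].
have [l bl] := Hnbr b.
(* Both [(i, b)] and [(i, l)] land in the singleton of [v], forcing [l = b], a loop in [H]. *)
have := Wv (i, b); rewrite !inE /= /strong_adj /= !eqxx ai_adj /= orbT orbT.
have := Wv (i, l); rewrite !inE /= /strong_adj /= !eqxx ai_adj bl /=.
move=> /esym/eqP <- /esym/eqP[eq_bl].
by rewrite eq_bl adj_irrefl in bl.
Qed.

Lemma card_fiber_complement (S T : finType) (i : S) :
  #|~: [set x : S * T | x.1 == i]| = #|S|.-1 * #|T|.
Proof.
rewrite (_ : ~: _ = setX [set~ i] setT) ?cardsX ?cardsC1 ?cardsT //.
by apply/setP => x; rewrite !inE andbT.
Qed.

(* [uphalf k] is the ceiling of k / 2. *)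
Theorem theorem3p11 (m n : nat) (hm : 2 < m) (hn : 2 < n) :
  uphalf (m * n) <= failed_zf_number (strong_product (cycle_graph m) (cycle_graph n)).
Proof.
pose i : cycle_graph m := Ordinal (ltnW (ltnW hm)).
pose j : cycle_graph n := Ordinal (ltnW (ltnW hn)).
have failed := fiber_complement_failed _ _ i j
  (fun k => cycle_has_neighbor n k (ltnW hn)).
apply: leq_trans (leq_bigmax_cond _ failed).
rewrite (card_fiber_complement (cycle_graph m) (cycle_graph n) i) !card_ord.
(* It suffices that [m * n <= 2 * (m - 1) * n], which holds once [2 <= m]. *)
by nia.
Qed.
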